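(* Let $X$ be a Banach space, $Y$ an ordered Banach space with closed positive cone, and $S: D(S)\subset X\to Y$ a closed linear operator. Assume that $(A,D(A))$ generates an $S$-shape preserving strongly continuous semigroup $(e^{tA})_{t\ge 0}$ on $X$ and that $B\in\mathcal{L}(X)$ is a bounded linear operator leaving $C$ invariant, i.e., $BC\subset C$. Then the semigroup generated by $(A+B,D(A))$ is $S$-shape preserving.
   Context: For a closed operator $S:D(S)\subset X\to Y$ put $C:=\overline{\{x\in D(S): Sx\ge 0\}}$, and for a generator $(A,D(A))$ of a strongly continuous semigroup on $X$ put $C_A:=\overline{\{x\in D(A)\cap D(S): Sx\ge 0\}}$ (closures in $X$). The semigroup generated by $A$ is called $S$-shape preserving if (a) $C=C_A$ and (b) the semigroup leaves $C$ invariant. *)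

(* Defs.v *)
From HB Require Import structures.
From mathcomp Require Import all_boot all_order all_algebra.
From mathcomp Require Import all_classical all_reals all_analysis.

Set Implicit Arguments.
Unset Strict Implicit.
Unset Printing Implicit Defensive.

Import Order.TTheory GRing.Theory Num.Theory.
Import numFieldNormedType.Exports.

Local Open Scope classical_set_scope.
Local Open Scope ring_scope.

(* An unbounded linear operator D(S) \subset X -> Y.  Only the values of [op]
   on [dom] are meaningful; they are arbitrary elsewhere. *)
Record operator (R : realType) (X Y : normedModType R) := Operator {
  dom : set X;
  op :> X -> Y;
  dom0 : dom 0;
  domP : forall (a : R) (x y : X), dom x -> dom y -> dom (a *: x + y);
  opP : forall (a : R) (x y : X), dom x -> dom y ->
    op (a *: x + y) = a *: op x + op y
}.

Definition closed_operator (R : realType) (X Y : normedModType R)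
    (S : operator X Y) : Prop :=
  closed [set p : X * Y | dom S p.1 /\ p.2 = S p.1].

Section Perturbation.
Context (R : realType) (X : normedModType R).
Variables (A : operator X X) (B : {linear X -> X}).

Lemma perturbP (a : R) (x y : X) : dom A x -> dom A y ->
  A (a *: x + y) + B (a *: x + y) = a *: (A x + B x) + (A y + B y).
Proof. by move=> Ax Ay; rewrite opP// linearP scalerDr addrACA. Qed.

(* (A + B, D(A)) *)
Definition perturb : operator X X :=
  @Operator R X X (dom A) (fun x => A x + B x) (@dom0 _ _ _ A)
    (@domP _ _ _ A) perturbP.
End Perturbation.

Record vector_order (R : realType) (Y : normedModType R)
    (le : Y -> Y -> Prop) : Prop := VectorOrder {
  vle_refl : forall x, le x x;
  vle_anti : forall x y, le x y -> le y x -> x = y;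
  vle_trans : forall x y z, le x y -> le y z -> le x z;
  vle_add : forall x y z, le x y -> le (x + z) (y + z);
  vle_scale : forall (a : R) x y, 0 <= a -> le x y -> le (a *: x) (a *: y)
}.

Definition positive_cone (R : realType) (Y : normedModType R)
    (le : Y -> Y -> Prop) : set Y := [set y | le 0 y].

(* Only the operators [T t] with [0 <= t] are relevant. *)
Record C0_semigroup (R : realType) (X : normedModType R)
    (T : R -> {linear X -> X}) : Prop := C0Semigroup {
  sg_continuous : forall t, 0 <= t -> continuous (T t);
  sg0 : forall x, T 0 x = x;
  sgD : forall s t x, 0 <= s -> 0 <= t -> T (s + t) x = T s (T t x);
  sg_strong : forall x, T t x @[t --> 0^'+] --> x
}.

Definition diff_quotient (R : realType) (X : normedModType R)
    (T : R -> {linear X -> X}) (x : X) (h : R) : X := h^-1 *: (T h x - x).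

Definition is_generator (R : realType) (X : normedModType R)
    (A : operator X X) (T : R -> {linear X -> X}) : Prop :=
  dom A = [set x | cvg (diff_quotient T x h @[h --> 0^'+])] /\
  forall x, dom A x -> diff_quotient T x h @[h --> 0^'+] --> A x.

Definition generates (R : realType) (X : normedModType R)
    (A : operator X X) (T : R -> {linear X -> X}) : Prop :=
  C0_semigroup T /\ is_generator A T.

Definition shape_cone (R : realType) (X Y : normedModType R)
    (le : Y -> Y -> Prop) (S : operator X Y) : set X :=
  closure [set x | dom S x /\ le 0 (S x)].

Definition shape_cone_on (R : realType) (X Y : normedModType R)
    (le : Y -> Y -> Prop) (S : operator X Y) (A : operator X X) : set X :=
  closure [set x | (dom A `&` dom S) x /\ le 0 (S x)].

(* [T] is meant to be the semigroup generated by [A]. *)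
Definition shape_preserving (R : realType) (X Y : normedModType R)
    (le : Y -> Y -> Prop) (S : operator X Y) (A : operator X X)
    (T : R -> {linear X -> X}) : Prop :=
  shape_cone le S = shape_cone_on le S A /\
  forall t, 0 <= t -> T t @` shape_cone le S `<=` shape_cone le S.

(* Main.v *)
Require Import Defs.
From HB Require Import structures.
From mathcomp Require Import all_boot all_order all_algebra.
From mathcomp Require Import all_classical all_reals all_analysis.
From mathcomp Require Import ring lra.

Set Implicit Arguments.
Unset Strict Implicit.
Unset Printing Implicit Defensive.

Import Order.TTheory GRing.Theory Num.Theory.
Import numFieldNormedType.Exports.

Local Open Scope classical_set_scope.
Local Open Scope ring_scope.

(* The semigroup of A + B is the Dyson-Phillips series: T_0 = T and
   T_(n+1)(t) x = \int_0^t T(r) B T_n(t - r) x dr.  Weighting the sup norm on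
   [0, N] by e^(lam t) with lam large makes the Volterra operator a contraction,
   so the series converges geometrically and its sum U is the unique solution of
   U(t) x = T(t) x + \int_0^t T(r) B U(t - r) x dr; uniqueness yields the
   semigroup law, and dividing by t shows that U is generated by A + B with
   domain exactly D(A).  The closed convex cone C is invariant under T, B and
   integration, hence under every T_n and under U.  Finally a semigroup is
   determined by its generator, because s |-> T1(t - s) T2(s) x has zero right
   derivative on the (dense) domain.  As D(A + B) = D(A), the condition
   C = C_(A+B) is the hypothesis C = C_A. *)

(** * Metric characterisations of limits *)

Section EpsilonDelta.
Context (R : realType) (X : normedModType R).
Implicit Types (f : R -> X) (u : nat -> X) (l : X).

Lemma continuous_distP f : continuous f <->
  forall s (e : R), 0 < e -> exists2 d : R, 0 < d &
    forall t, `|t - s| < d -> `|f t - f s| <= e.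
Proof.
split=> [cf s e e0|H s].
  have /cvgrPdist_le/(_ e e0)/nbhs_ballP[d /= d0 dP] := cf s.
  exists d => // t ts; rewrite distrC; apply: dP.
  by rewrite /ball/= distrC.
apply/cvgrPdist_le => e e0; have [d d0 dP] := H s e e0.
apply/nbhs_ballP; exists d => //= t; rewrite /ball/= distrC => ts.
by rewrite distrC; exact: dP.
Qed.

Lemma cvg_at_right_distP f l : f h @[h --> 0^'+] --> l <->
  forall e : R, 0 < e -> exists2 d : R, 0 < d &
    forall h, 0 < h -> h < d -> `|f h - l| <= e.
Proof.
split=> [cf e e0|H].
  have /cvgrPdist_le/(_ e e0) := cf.
  rewrite near_withinE => /nbhs_ballP[d /= d0 dP].
  exists d => // h h0 hd; rewrite distrC; apply: dP => //.
  by rewrite /ball/= sub0r normrN gtr0_norm.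
apply/cvgrPdist_le => e e0; have [d d0 dP] := H e e0.
rewrite near_withinE; apply/nbhs_ballP; exists d => //= h.
rewrite /ball/= sub0r normrN => hd h0; rewrite distrC; apply: dP => //.
by rewrite gtr0_norm in hd.
Qed.

Lemma cvgn_distP u l : u n @[n --> \oo] --> l <->
  forall e : R, 0 < e -> exists N, forall n, (N <= n)%N -> `|u n - l| <= e.
Proof.
split=> [cf e e0|H].
  have /cvgrPdist_le/(_ e e0)[N _ NP] := cf.
  by exists N => n Nn; rewrite distrC; exact: NP.
apply/cvgrPdist_le => e e0; have [N NP] := H e e0.
by exists N => //= n /= Nn; rewrite distrC; exact: NP.
Qed.

(** Compactness in its near-covering form, along radii tending to 0 from the right. Only [s] is
    confined to the interval, because Riemann nodes slightly to its left are compared with [s]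
    later. *)
Lemma uniformly_continuous_itv f (a b : R) : continuous f ->
  forall e : R, 0 < e -> exists2 d : R, 0 < d &
    forall s t, a <= s <= b -> `|t - s| < d -> `|f t - f s| <= e.
Proof.
move=> /continuous_distP cf e e0.
have /compact_near_coveringP/near_covering_withinP := @segment_compact R a b.
move=> /(_ _ (0^'+) (fun d s => forall t, `|t - s| < d -> `|f t - f s| <= e) _).
case.
- move=> s _; have [d d0 dP] := cf s _ (divr_gt0 e0 (ltr0n R 2)).
  exists (ball s (d / 2), [set d' | d' < d / 2]).
    split; first by apply: nbhsx_ballx; rewrite divr_gt0.
    by apply: nbhs_right_lt; rewrite divr_gt0.
  move=> [r d'] [/= rs d'd] _ t tr.
  rewrite /ball/= distrC in rs.
  have -> : f t - f r = (f t - f s) - (f r - f s) by rewrite opprB addrA subrK.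
  apply: le_trans (ler_normB _ _) _; rewrite [e]splitr lerD//; apply: dP.
    have -> : t - s = (t - r) + (r - s) by rewrite addrA subrK.
    apply: le_lt_trans (ler_normD _ _) _; lra.
  by lra.
- move=> d /= d0 dP; exists (d / 2); first by rewrite divr_gt0.
  move=> s t st ts; apply: (dP (d / 2)) => //=.
  by rewrite sub0r normrN gtr0_norm ?divr_gt0//; lra.
by rewrite divr_gt0.
Qed.

(** Bounds on short increments telescope along steps of length at most [d]. This serves as a mean
    value inequality, with [phi] as a primitive of the bound. *)
Lemma increment_chain f (phi : R -> R) (a b d : R) : 0 < d -> a <= b ->
  (forall s t, a <= s -> s <= t -> t <= b -> t - s <= d ->
     `|f t - f s| <= phi t - phi s) ->
  `|f b - f a| <= phi b - phi a.
Proof.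
move=> d0 ab H.
suff K n c : a <= c -> c <= b -> c - a <= n%:R * d ->
    `|f c - f a| <= phi c - phi a.
  have q0 : 0 <= (b - a) / d by rewrite divr_ge0 ?subr_ge0// ltW.
  apply: (K (Num.bound ((b - a) / d))) => //.
  by rewrite -ler_pdivrMr// ltW// archi_boundP.
elim: n c => [|n IH] c ac cb.
  rewrite mul0r subr_le0 => ca.
  have -> : c = a by apply/eqP; rewrite eq_le ca ac.
  by rewrite !subrr normr0.
rewrite -natr1 mulrDl mul1r => can.
(* One step back from [c], stopped at [a]. *)
pose s := Num.max a (c - d).
have as_ : a <= s by rewrite le_max lexx.
have sc : s <= c by rewrite ge_max ac gerBl ltW.
have -> : f c - f a = (f c - f s) + (f s - f a) by rewrite addrA subrK.
have -> : phi c - phi a = (phi c - phi s) + (phi s - phi a).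
  by rewrite addrA subrK.
apply: le_trans (ler_normD _ _) _; apply: lerD.
  apply: H => //; have : c - d <= s by rewrite le_max lexx orbT.
  by lra.
apply: IH => //; first exact: le_trans sc cb.
rewrite lerBlDr ge_max; apply/andP; split; last by lra.
by rewrite lerDr mulr_ge0 ?ler0n// ltW.
Qed.

End EpsilonDelta.

Definition closed_cone (R : realType) (X : normedModType R) (K : set X) :=
  [/\ closed K, K 0 & forall (a b : R) x y,
     0 <= a -> 0 <= b -> K x -> K y -> K (a *: x + b *: y)].

(** * Integral of a continuous vector-valued function *)

Section Integral.
Context (R : realType) (X : completeNormedModType R).
Implicit Types (f g : R -> X) (c : X).

(* For [0 <= t]: the length of the part of the [k]-th cell of the grid of mesh
   [1 / n.+1] that lies below [t].  Clamping the cells at [t], rather than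
   subdividing [[0, t]], makes the Riemann sums additive in [t]. *)
Definition cell (n k : nat) (t : R) : R :=
  Num.min t (k.+1%:R / n.+1%:R) - Num.min t (k%:R / n.+1%:R).

Definition riemann_sum f (n : nat) (t : R) : X :=
  \sum_(k < n.+1 ^ 2) cell n k t *: f (k%:R / n.+1%:R).

(* The integral over [[0, t]]; it is [0] for [t <= 0] ([vintegral_le0]). *)
Definition vintegral f (t : R) : X := lim (riemann_sum f n t @[n --> \oo]).

Lemma sum_cell n m t : 0 <= t -> \sum_(k < m) cell n k t =
  Num.min t (m%:R / n.+1%:R).
Proof.
move=> t0; rewrite -(big_mkord predT (fun k => cell n k t)).
rewrite (telescope_sumr (fun k => Num.min t (k%:R / n.+1%:R)))// mul0r.
by rewrite (min_idPr t0) subr0.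
Qed.

(** The difference is the length of the part of the cell inside [[s, t]]. If it is nonzero, the cell
    meets [[s, t]], so its left node is at most [t] and at most one mesh below [s]. *)
Lemma cell_incr n k s t : s <= t ->
  0 <= cell n k t - cell n k s /\
  (cell n k t - cell n k s != 0 ->
     s - n.+1%:R^-1 <= k%:R / n.+1%:R <= t).
Proof.
move=> st; rewrite /cell -natr1 mulrDl mul1r.
have : (0 : R) < n.+1%:R^-1 by rewrite invr_gt0 ltr0n.
set h := n.+1%:R^-1; set x := k%:R * h; move=> h0.
rewrite /Num.min; case: ifPn; rewrite -?leNgt; case: ifPn; rewrite -?leNgt;
 case: ifPn; rewrite -?leNgt; case: ifPn; rewrite -?leNgt => *;
 (split; [lra | move=> /eqP ?; apply/andP; split; lra]).
Qed.

(** The cell increments are nonnegative weights of total [t - s], carried by nodes between [s] minus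
    one mesh and [t]. The [n.+1 ^ 2] cells reach up to [n.+1], so the bound on [t] makes the grid
    cover [[s, t]]. *)
Lemma riemann_sum_increment f n s t c e : 0 <= s -> s <= t -> t <= n.+1%:R ->
  (forall r, s - n.+1%:R^-1 <= r <= t -> `|f r - c| <= e) ->
  `|riemann_sum f n t - riemann_sum f n s - (t - s) *: c| <= (t - s) * e.
Proof.
move=> s0 st tn H.
have tot : \sum_(k < n.+1 ^ 2) (cell n k t - cell n k s) = t - s.
  rewrite sumrB !sum_cell//; last exact: le_trans st.
  have -> : (n.+1 ^ 2)%:R / n.+1%:R = n.+1%:R :> R.
    by rewrite natrX expr2 mulfK// pnatr_eq0.
  by rewrite !min_l//; exact: le_trans tn.
rewrite -sumrB -{1}tot scaler_suml -sumrB.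
apply: le_trans (ler_norm_sum _ _ _) _; rewrite -tot mulr_suml.
apply: ler_sum => k _; rewrite -scalerBl -scalerBr normrZ.
have [p q] := cell_incr n k st.
rewrite (ger0_norm p); have [->|/q /H ?] := eqVneq (cell n k t - cell n k s) 0.
  by rewrite !mul0r.
exact: ler_wpM2l.
Qed.

Lemma riemann_sum0 f n : riemann_sum f n 0 = 0.
Proof.
rewrite /riemann_sum big1// => k _; rewrite /cell !min_l ?subrr ?scale0r//;
by rewrite divr_ge0.
Qed.

Lemma invS_lt (d : R) : 0 < d -> exists N, forall n, (N <= n)%N ->
  n.+1%:R^-1 < d.
Proof.
move=> d0; exists (Num.bound d^-1) => n Nn.
rewrite invf_plt ?posrE ?ltr0n//.
apply: (@lt_le_trans _ _ (Num.bound d^-1)%:R).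
  by rewrite archi_boundP// invr_ge0 ltW.
by rewrite ler_nat leqW.
Qed.

(** The sums are Cauchy: on a short interval starting at [s] any two fine sums both grow by nearly
    its length times [f s], and [increment_chain] adds up the discrepancies over [[0, t]]. *)
Lemma riemann_sum_cvg f t : continuous f -> 0 <= t ->
  riemann_sum f n t @[n --> \oo] --> vintegral f t.
Proof.
move=> cf t0; apply/cauchy_cvgP/cauchy_ballP => e e0.
(* Two errors of this size accumulate over [[0, t]] to [t * e / (2 * (t + 1)) < e]; the summand 1
   covers [t = 0]. *)
have e1 : 0 < e / (4 * (t + 1)) by rewrite divr_gt0// mulr_gt0//; lra.
have [d d0 dP] := uniformly_continuous_itv 0 t cf e1.
have d20 : 0 < d / 2 by rewrite divr_gt0.
have [N NP] := invS_lt d20.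
(* From [N] on the mesh is below [d / 2]; from [Num.bound t] on the grid covers [[0, t]]. *)
pose M := maxn N (Num.bound t).
have main n s r : (M <= n)%N -> 0 <= s -> s <= r -> r <= t -> r - s <= d / 4 ->
  `|riemann_sum f n r - riemann_sum f n s - (r - s) *: f s| <=
    (r - s) * (e / (4 * (t + 1))).
  rewrite geq_max => /andP[Nn tn] s0 sr rt rs.
  apply: riemann_sum_increment => //.
    apply: le_trans rt _; apply: ltW.
    apply: lt_le_trans (archi_boundP t0) _; by rewrite ler_nat leqW.
  move=> x /andP[sx xr]; apply: dP; first by apply/andP; split; lra.
  move: (NP _ Nn) sx; move: (_^-1) => h hd sx.
  by rewrite ltr_norml; apply/andP; split; lra.
rewrite near_map2; exists ([set n | (M <= n)%N], [set n | (M <= n)%N]).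
  by split; exists M.
move=> [n m] [/= Mn Mm]; rewrite -ball_normE /=.
have := @increment_chain _ _ (fun r => riemann_sum f n r - riemann_sum f m r)
   (fun r => r * (e / (2 * (t + 1)))) 0 t (d / 4).
rewrite !riemann_sum0 !subr0 mul0r subr0 => /(_ _ t0) H.
apply: le_lt_trans (H _ _) _; first by rewrite divr_gt0.
- move=> s r s0 sr rt rs.
  have := main _ _ _ Mn s0 sr rt rs; have := main _ _ _ Mm s0 sr rt rs.
  set a := _ - _ - _ => ha; set b := _ - _ - _ => hb.
  rewrite (_ : _ - _ = b - a).
    apply: le_trans (ler_normB _ _) _.
    apply: le_trans (lerD hb ha) _; rewrite -mulrDr -mulrBl.
    by rewrite ler_wpM2l ?subr_ge0// !invfM; lra.
  rewrite /a /b [in RHS]opprB addrA subrK.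
  rewrite !opprB addrACA [RHS]addrACA; congr (_ + _).
  by rewrite addrC.
- by rewrite mulrA ltr_pdivrMr ?mulr_gt0//; nra.
Qed.

Lemma cvgn_norm_le (u : nat -> X) l (K : R) N : u n @[n --> \oo] --> l ->
  (forall n, (N <= n)%N -> `|u n| <= K) -> `|l| <= K.
Proof.
move=> /cvgn_distP ul uK; apply/ler_addgt0Pr => e e0.
have [M MP] := ul e e0; have Mm := MP _ (leq_maxr N M).
have := uK _ (leq_maxl N M) => h.
rewrite -(subrK (u (maxn N M)) l) addrC; apply: le_trans (ler_normD _ _) _.
by rewrite lerD// distrC.
Qed.

(** The limit of [riemann_sum_increment]. That lemma also wants the bound one mesh to the left of
    [s]; continuity at [s] provides it up to an arbitrary [eta]. *)
Lemma vintegral_increment f s t c (e : R) : continuous f -> 0 <= s -> s <= t ->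
  (forall r, s <= r <= t -> `|f r - c| <= e) ->
  `|vintegral f t - vintegral f s - (t - s) *: c| <= (t - s) * e.
Proof.
move=> cf s0 st H; have t0 := le_trans s0 st.
suff K (eta : R) : 0 < eta ->
    `|vintegral f t - vintegral f s - (t - s) *: c| <= (t - s) * (e + eta).
  apply/ler_addgt0Pr => eta eta0.
  have ts1 : 0 < t - s + 1 by lra.
  apply: le_trans (K (eta / (t - s + 1)) _) _; first by rewrite divr_gt0.
  rewrite mulrDr lerD2l mulrA ler_pdivrMr// mulrC ler_pM2l//; lra.
move=> eta0; have /continuous_distP/(_ s eta eta0)[d d0 dP] := cf.
have [N NP] := invS_lt d0.
have cv : riemann_sum f n t - riemann_sum f n s - (t - s) *: c @[n --> \oo] -->
          vintegral f t - vintegral f s - (t - s) *: c.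
  by apply: cvgB; [apply: cvgB; exact: riemann_sum_cvg | exact: cvg_cst].
apply: (cvgn_norm_le (N := maxn N (Num.bound t)) cv) => n.
rewrite geq_max => /andP[Nn tn]; apply: riemann_sum_increment => //.
  by apply: le_trans (ltW (archi_boundP t0)) _; rewrite ler_nat leqW.
move: (NP _ Nn); move: (_^-1) => h hd r /andP[sr rt].
have [rs|rs] := leP s r.
  by apply: le_trans (H _ _) _; rewrite ?rs// lerDl ltW.
rewrite -(subrK (f s) (f r)) -addrA addrC; apply: le_trans (ler_normD _ _) _.
apply: lerD; first by apply: H; rewrite lexx.
by apply: dP; rewrite ltr_norml; apply/andP; split; lra.
Qed.

Lemma vintegral_0 f : vintegral f 0 = 0.
Proof.
rewrite /vintegral (_ : (fun n => _) = cst 0); last first.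
  by apply/funext => n; exact: riemann_sum0.
exact: lim_cst.
Qed.

Lemma vintegral_dist f t c (e : R) : continuous f -> 0 <= t ->
  (forall r, 0 <= r <= t -> `|f r - c| <= e) ->
  `|vintegral f t - t *: c| <= t * e.
Proof.
move=> cf t0 H; have := vintegral_increment cf (lexx 0) t0 H.
by rewrite vintegral_0 !subr0.
Qed.

Lemma vintegral_norm_le f t (e : R) : continuous f -> 0 <= t ->
  (forall r, 0 <= r <= t -> `|f r| <= e) -> `|vintegral f t| <= t * e.
Proof.
move=> cf t0 H; have := @vintegral_dist f t 0 e cf t0.
rewrite scaler0 subr0; apply => r /H; by rewrite subr0.
Qed.

Lemma riemann_sumB f g n t :
  riemann_sum (fun r => f r - g r) n t = riemann_sum f n t - riemann_sum g n t.
Proof. by rewrite -sumrB; apply: eq_bigr => k _; rewrite scalerBr. Qed.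

Lemma vintegralB f g t : continuous f -> continuous g -> 0 <= t ->
  vintegral (fun r => f r - g r) t = vintegral f t - vintegral g t.
Proof.
move=> cf cg t0; apply: cvg_lim => //; under eq_fun do rewrite riemann_sumB.
by apply: cvgB; exact: riemann_sum_cvg.
Qed.

Lemma vintegral_linear (L : {linear X -> X}) f t : continuous L ->
  continuous f -> 0 <= t -> vintegral (fun r => L (f r)) t = L (vintegral f t).
Proof.
move=> cL cf t0; apply: cvg_lim => //.
have -> : riemann_sum (fun r => L (f r)) ^~ t = L \o riemann_sum f ^~ t.
  apply/funext => n /=; rewrite linear_sum; apply: eq_bigr => k _.
  by rewrite linearZ.
by apply: continuous_cvg; [exact: cL | exact: riemann_sum_cvg].
Qed.

Lemma vintegral_comb (a : R) f g t : continuous f -> continuous g -> 0 <= t ->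
  vintegral (fun r => a *: f r + g r) t = a *: vintegral f t + vintegral g t.
Proof.
move=> cf cg t0; apply: cvg_lim => //.
have -> : riemann_sum (fun r => a *: f r + g r) ^~ t =
    (fun n => a *: riemann_sum f n t + riemann_sum g n t).
  apply/funext => n; rewrite scaler_sumr -big_split; apply: eq_bigr => k _ /=.
  by rewrite scalerDr !scalerA mulrC.
apply: cvgD; last exact: riemann_sum_cvg.
by apply: cvgZl_tmp; exact: riemann_sum_cvg.
Qed.

(** Riemann sums are combinations of points of [K] with nonnegative weights, and [K] is closed. *)
Lemma vintegral_cone K f t : closed_cone K -> continuous f -> 0 <= t ->
  (forall r, 0 <= r -> K (f r)) -> K (vintegral f t).
Proof.
move=> [clK K0 KD] cf t0 Kf.
apply: (closed_cvg K clK _ _ (riemann_sum_cvg cf t0)); apply: nearW => n.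
rewrite /riemann_sum; elim/big_ind: _ => //.
  by move=> x y Kx Ky; have := KD 1 1 _ _ ler01 ler01 Kx Ky; rewrite !scale1r.
move=> k _; have := KD (cell n k t) 0 (f (k%:R / n.+1%:R)) 0.
rewrite scaler0 addr0; apply => //; last by apply: Kf; rewrite divr_ge0.
have [+ _] := cell_incr n k t0.
by rewrite [cell n k 0]/cell !(@min_l _ _ 0) ?divr_ge0// subrr subr0.
Qed.

Lemma eq_vintegral f g t : continuous f -> continuous g -> 0 <= t ->
  (forall r, 0 <= r <= t -> f r = g r) -> vintegral f t = vintegral g t.
Proof.
move=> cf cg t0 fg; apply/eqP; rewrite -subr_eq0 -vintegralB// -normr_le0.
rewrite -(mulr0 t); apply: vintegral_norm_le => //.
  by move=> x; apply: cvgB; [exact: cf|exact: cg].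
by move=> r /fg ->; rewrite subrr normr0.
Qed.

(** The grid is not invariant under the shift by [s], so the Riemann sums do not match. Instead the
    difference [D] of the two integrals is shown to be constant: on a short step from [p] both grow
    by nearly the step length times [f (s + p)]. *)
Lemma vintegralD f s t : continuous f -> 0 <= s -> 0 <= t ->
  vintegral f (s + t) = vintegral f s + vintegral (fun r => f (s + r)) t.
Proof.
move=> cf s0 t0.
have cfs : continuous (fun r => f (s + r)).
  move=> x; apply: (@continuous_comp _ _ _ (fun r => s + r) f).
    by apply: cvgD; [exact: cvg_cst|exact: cvg_id].
  exact: cf.
pose D r := vintegral f (s + r) - vintegral (fun r => f (s + r)) r.
suff : `|D t - D 0| <= 0.
  rewrite /D addr0 vintegral_0 subr0 normr_le0 subr_eq0 => /eqP <-.
  by rewrite subrK.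
apply/ler_addgt0Pr => e e0; rewrite add0r.
pose e1 := e / (2 * (t + 1)).
have e10 : 0 < e1 by rewrite divr_gt0// mulr_gt0//; lra.
have [d d0 dP] := uniformly_continuous_itv 0 (s + t) cf e10.
have := @increment_chain _ _ D (fun r => r * (2 * e1)) 0 t (d / 2).
rewrite mul0r subr0 => H; apply: le_trans (H _ _ _) _ => //.
- by rewrite divr_gt0.
- move=> p q p0 pq qt pqd.
  have a1 : `|vintegral f (s + q) - vintegral f (s + p) - (q - p) *: f (s + p)|
     <= (q - p) * e1.
    have -> : q - p = (s + q) - (s + p) by lra.
    apply: vintegral_increment => //; [lra | lra |].
    move=> r /andP[r1 r2]; apply: dP; first by apply/andP; split; lra.
    by rewrite ltr_norml; apply/andP; split; lra.
  have a2 : `|vintegral (fun r => f (s + r)) q -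
     vintegral (fun r => f (s + r)) p - (q - p) *: f (s + p)| <= (q - p) * e1.
    apply: vintegral_increment => //.
    move=> r /andP[r1 r2]; apply: dP; first by apply/andP; split; lra.
    by rewrite ltr_norml; apply/andP; split; lra.
  rewrite -mulrBl mulrCA mulr2n mulrDl mul1r.
  apply: le_trans (lerD a1 a2); apply: le_trans (ler_normB _ _).
  have E (a b c g v : X) : a - b - (c - g) = (a - c - v) - (b - g - v).
    rewrite (opprB (b - g) v) addrA subrK !opprB addrACA [RHS]addrACA.
    by rewrite [- b - c]addrC.
  by rewrite /D (E _ _ _ _ ((q - p) *: f (s + p))).
- have : e1 * (2 * (t + 1)) = e by rewrite divfK// mulf_neq0 ?gt_eqF//; lra.
  by move: e10; nra.
Qed.

End Integral.

(** * Continuity of the integral in its endpoint and in a parameter *)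

Lemma continuous_pair (S U V : topologicalType) (f : S -> U) (g : S -> V) :
  continuous f -> continuous g -> continuous (fun x => (f x, g x)).
Proof. by move=> cf cg x; exact: (cvg_pair (cf x) (cg x)). Qed.

Lemma continuous_compT (S U V : topologicalType) (f : S -> U) (g : U -> V) :
  continuous f -> continuous g -> continuous (fun x => g (f x)).
Proof. by move=> cf cg x; exact: (continuous_comp (cf x) (cg (f x))). Qed.

Section IntegralContinuity.
Context (R : realType) (X : completeNormedModType R).

Lemma vintegral_le0 (f : R -> X) t : t <= 0 -> vintegral f t = 0.
Proof.
move=> t0; rewrite /vintegral (_ : (fun n => _) = cst 0) ?lim_cst//.
apply/funext => n; apply: big1 => k _.
by rewrite /cell !min_l ?subrr ?scale0r//; apply: le_trans t0 _; rewrite divr_ge0.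
Qed.

Lemma vintegral_max (f : R -> X) t :
  vintegral f (Num.max t 0) = vintegral f t.
Proof.
by have [t0|t0] := leP t 0; rewrite // vintegral_0 vintegral_le0.
Qed.

Lemma ler_dist_max0 (s t : R) : `|Num.max s 0 - Num.max t 0| <= `|s - t|.
Proof.
have h1 := ler_norm (s - t); have h2 := ler_norm (t - s).
rewrite distrC in h2; rewrite ler_norml.
by case: (leP s 0) => ?; case: (leP t 0) => ?; apply/andP; split; lra.
Qed.

(** Near [s] the integrand is bounded by the constant [C], so the integral is Lipschitz there.
    Negative endpoints reduce to 0, clamping being 1-Lipschitz. *)
Lemma vintegral_continuous (g : R -> X) : continuous g ->
  continuous (vintegral g).
Proof.
move=> cg; apply/continuous_distP => s0 e e0.
pose s := Num.max s0 0.
have sge : 0 <= s by rewrite le_max lexx orbT.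
have [d d0 dP] := (continuous_distP g).1 cg s 1 ltr01.
pose C := `|g s| + 1; have C0 : 0 < C by rewrite ltr_wpDl.
have main a b : 0 <= a -> a <= b -> s - d < a -> b < s + d ->
    `|vintegral g b - vintegral g a| <= (b - a) * C.
  move=> a0 ab sa bs.
  have := @vintegral_increment _ _ g a b 0 C cg a0 ab.
  rewrite scaler0 subr0; apply => r /andP[ar rb]; rewrite subr0.
  rewrite -(subrK (g s) (g r)) addrC; apply: le_trans (ler_normD _ _) _.
  by rewrite lerD2l; apply: dP; rewrite ltr_norml; apply/andP; split; lra.
exists (Num.min d (e / C)); first by rewrite lt_min d0 divr_gt0.
move=> t0; rewrite lt_min ltr_pdivlMr// => /andP[td te].
rewrite -(vintegral_max g s0) -(vintegral_max g t0) -/s.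
pose t := Num.max t0 0; rewrite -/t.
have tge : 0 <= t by rewrite le_max lexx orbT.
have ts := ler_dist_max0 t0 s0; rewrite -/t -/s in ts.
have tsd := le_lt_trans ts td; rewrite ltr_norml in tsd.
have {}te := le_trans (ler_wpM2r (ltW C0) ts) (ltW te).
have [st|st] := leP s t.
  apply: le_trans (main s t _ _ _ _) _ => //; try lra.
  by rewrite ger0_norm ?subr_ge0// in te.
rewrite distrC; apply: le_trans (main t s _ _ _ _) _ => //; try lra.
by rewrite distrC gtr0_norm ?subr_gt0// in te.
Qed.

(** Moving [t] changes the integrand and the endpoint. The first change is small uniformly on
    [[0, N]] by compactness, the second by [vintegral_continuous]. *)
Lemma parametric_vintegral_continuous (f : R -> R -> X) :
  continuous (fun p : R * R => f p.1 p.2) ->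
  continuous (fun t => vintegral (f t) t).
Proof.
move=> cf; apply/continuous_distP => s e e0.
have cfs t : continuous (f t).
  apply: (continuous_compT (f := pair t)) cf.
  by apply: (@continuous_pair _ _ _ (cst t) id) => x; [exact: cvg_cst|].
(* Bounds every endpoint at distance less than 1 from [s]. *)
pose N := Num.max s 0 + 1.
have N0 : 0 < N by rewrite ltr_wpDl// le_max lexx orbT.
have e1 : 0 < e / 2 / N by rewrite !divr_gt0.
have [d1 d10 d1P] : exists2 d : R, 0 < d & forall t, `|t - s| < d ->
    forall r, 0 <= r <= N -> `|f t r - f s r| <= e / 2 / N.
  have /compact_near_coveringP/near_covering_withinP := @segment_compact R 0 N.
  move=> /(_ _ (nbhs s) (fun t r => `|f t r - f s r| <= e / 2 / N) _) [].
    move=> r _; have e2 : 0 < e / 2 / N / 2 by rewrite divr_gt0.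
    have /cvgrPdist_le/(_ _ e2)[[U V] /= [Us Vr] UV] := cf (s, r).
    exists (V, U) => //= -[r' t] [/= Vr' Ut] _.
    have h1 := UV (t, r') (conj Ut Vr').
    have h2 := UV (s, r') (conj (nbhs_singleton Us) Vr').
    rewrite /= in h1 h2.
    have -> : f t r' - f s r' = (f s r - f s r') - (f s r - f t r').
      by rewrite opprB [RHS]addrC addrA subrK.
    apply: le_trans (ler_normB _ _) _; lra.
  move=> d /= d0 dP; exists d => // t ts r rN.
  by apply: dP; rewrite /= ?in_itv//= distrC.
have [d2 d20 d2P] := (continuous_distP _).1 (vintegral_continuous (cfs s)) s
  _ (divr_gt0 e0 (ltr0n R 2)).
exists (Num.min (Num.min d1 d2) 1); first by rewrite !lt_min d10 d20 ltr01.
move=> t; rewrite !lt_min => /andP[/andP[td1 td2] t1].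
rewrite -(subrK (vintegral (f s) t) (vintegral (f t) t)) -addrA.
apply: le_trans (ler_normD _ _) _; rewrite [leRHS]splitr.
apply: lerD; last exact: d2P.
rewrite -(vintegral_max (f t)) -(vintegral_max (f s)).
have tge : 0 <= Num.max t 0 by rewrite le_max lexx orbT.
have tN : Num.max t 0 <= N.
  have := le_lt_trans (ler_dist_max0 t s) t1.
  rewrite ltr_norml /N; lra.
rewrite -vintegralB//; apply: le_trans (_ : Num.max t 0 * (e / 2 / N) <= _).
  apply: vintegral_norm_le => //.
    by move=> r; apply: cvgB; exact: cfs.
  by move=> r /andP[r0 rt]; apply: d1P => //; rewrite r0 (le_trans rt).
by rewrite mulrA ler_pdivrMr// mulrC ler_pM2l// divr_gt0.
Qed.

End IntegralContinuity.

Lemma continuous_linear_bound (R : realType) (X Y : normedModType R)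
    (L : {linear X -> Y}) : continuous L ->
  exists2 M : R, 0 < M & forall x, `|L x| <= M * `|x|.
Proof.
move=> /linear_bounded_continuous/linear_boundedP/pinfty_ex_gt0[M M0 LM].
by exists M.
Qed.

(** * Strongly continuous semigroups *)

Section Semigroup.
Context (R : realType) (X : completeNormedModType R).
Context (T : R -> {linear X -> X}) (sgT : C0_semigroup T).

(** Otherwise there are times [t_n < 1 / n.+1] at which [T t_n] stretches some vector by more than
    [n.+1]. Strong continuity at 0 bounds each orbit along these times, which contradicts the
    uniform boundedness principle. *)
Lemma semigroup_bounded_near0 : exists2 d : R, 0 < d &
  exists2 M : R, 1 <= M & forall t, 0 <= t < d -> forall x, `|T t x| <= M * `|x|.
Proof.
apply: contrapT => Hn.
have /choice[p pP] n : exists p : R * X,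
    (0 <= p.1 < n.+1%:R^-1) /\ n.+1%:R * `|p.2| < `|T p.1 p.2|.
  apply: contrapT => Hp; apply: Hn.
  exists n.+1%:R^-1; first by rewrite invr_gt0.
  exists n.+1%:R; first by rewrite ler1n.
  move=> t tn x; rewrite leNgt; apply/negP => h; apply: Hp.
  by exists (t, x).
pose F := [set g : X -> X | exists n, g = T (p n).1].
have /(_ _ _)[|x|M MP] := @Banach_Steinhauss R X X F _ _ 1.
- move=> _ [n ->]; split; last exact: linearP.
  have [/andP[p0 _] _] := pP n.
  have [M M0 MP] := continuous_linear_bound (sg_continuous sgT p0).
  move=> r; exists (M * r) => x xr.
  by apply: le_trans (MP _) _; rewrite ler_pM2l.
- have /cvg_at_right_distP/(_ 1 ltr01)[d d0 dP] := @sg_strong _ _ _ sgT x.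
  have [N NP] := invS_lt d0.
  (* From [N] on the orbit is within 1 of [x]; the finitely many earlier values are absorbed by
     their sum. *)
  pose C := `|x| + 1 + \sum_(n < N) `|T (p n).1 x|.
  exists C => _ [n ->].
  have s0 (K : nat) (P : pred 'I_K) : 0 <= \sum_(n < K | P n) `|T (p n).1 x|.
    by apply: sumr_ge0.
  have x0 : 0 <= `|x| by [].
  have [nN|Nn] := ltnP n N.
    rewrite /C (bigD1 (Ordinal nN))//=.
    by have := s0 _ (fun i => i != Ordinal nN); lra.
  have [/andP[p0 pn] _] := pP n.
  suff : `|T (p n).1 x - x| <= 1.
    move=> h; rewrite -(subrK x (T (p n).1 x)).
    apply: le_trans (ler_normD _ _) _.
    by have := s0 N predT; rewrite /C; lra.
  move: p0; rewrite le_eqVlt => /orP[/eqP <-|p0].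
    by rewrite (sg0 sgT) subrr normr0.
  by apply: dP => //; apply: lt_trans pn (NP _ Nn).
have [n nM] : exists n : nat, M < n.+1%:R.
  exists (Num.bound `|M|); apply: le_lt_trans (ler_norm _) _.
  by apply: lt_le_trans (archi_boundP (normr_ge0 _)) _; rewrite ler_nat.
have [_ pn] := pP n; pose x := (p n).2.
have x0 : 0 < `|x|.
  rewrite normr_gt0; apply/eqP => x0; move: pn.
  by rewrite -/x x0 linear0 normr0 mulr0 ltxx.
have := MP (T (p n).1) (ex_intro _ n erefl) (`|x|^-1 *: x).
rewrite linearZ !normrZ normfV normr_id mulVf ?gt_eqF// => /(_ (lexx _)).
rewrite ler_pdivrMl// leNgt => /negP; apply; apply: lt_trans pn.
by rewrite mulrC ltr_pM2r.
Qed.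

(** By the semigroup law, [n] steps of length at most [d / 2] cost a factor [M ^+ n]; the half keeps
    each step strictly below [d]. *)
Lemma semigroup_bounded (N : R) : exists2 M : R, 0 < M &
  forall t, 0 <= t <= N -> forall x, `|T t x| <= M * `|x|.
Proof.
have [d d0 [M M1 MP]] := semigroup_bounded_near0.
have M0 : 0 < M by apply: lt_le_trans M1.
have [N0|N0] := ltP N 0.
  exists 1 => // t /andP[t0 tN]; exfalso; lra.
have K n t : 0 <= t -> t <= n%:R * (d / 2) ->
    forall x, `|T t x| <= M ^+ n * `|x|.
  elim: n t => [|n IH] t t0.
    rewrite mul0r => t0' x; have -> : t = 0 by lra.
    by rewrite (sg0 sgT) expr0 mul1r.
  rewrite -natr1 mulrDl mul1r => tn x.
  have [td|td] := leP t (d / 2).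
    apply: le_trans (MP _ _ _) _; first by apply/andP; split; lra.
    by rewrite exprS ler_wpM2r// ler_peMr ?exprn_ege1// ltW.
  have -> : t = d / 2 + (t - d / 2) by lra.
  rewrite (sgD sgT); [|lra|lra].
  apply: le_trans (MP _ _ _) _; first by apply/andP; split; lra.
  by rewrite exprS -mulrA ler_pM2l//; apply: IH; lra.
exists (M ^+ Num.bound (N / (d / 2))); first exact: exprn_gt0.
move=> t /andP[t0 tN]; apply: K => //; apply: le_trans tN _.
rewrite -ler_pdivrMr ?divr_gt0//; apply: ltW; apply: archi_boundP.
by rewrite divr_ge0// divr_ge0// ltW.
Qed.

(** For [a <= b], [T b x - T a x = T a (T (b - a) x - x)]: with the local bound, right continuity at
    0 gives continuity of orbits from both sides. The same bound controls the change of vector. *)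
Lemma semigroup_jointly_continuous :
  continuous (fun p : R * X => T (Num.max p.1 0) p.2).
Proof.
move=> [s0 x]; apply/cvgrPdist_le => e e0 /=.
pose s := Num.max s0 0; rewrite -/s.
have sge : 0 <= s by rewrite le_max lexx orbT.
have [M M0 MP] := semigroup_bounded (s + 1).
have e1 : 0 < e / 2 / M by rewrite !divr_gt0.
have /cvg_at_right_distP/(_ _ e1)[d d0 dP] := @sg_strong _ _ _ sgT x.
have main a b : 0 <= a -> a <= b -> b <= s + 1 -> b - a < d ->
    `|T b x - T a x| <= e / 2.
  move=> a0 ab bs abd; have -> : b = a + (b - a) by lra.
  rewrite (sgD sgT)//; last lra.
  rewrite -linearB; apply: le_trans (MP _ _ _) _.
    by apply/andP; split; lra.
  rewrite -ler_pdivlMl//.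
  rewrite mulrC; move: ab; rewrite le_eqVlt => /orP[/eqP ->|ab].
    by rewrite subrr (sg0 sgT) subrr normr0 ltW.
  by apply: dP => //; lra.
exists (ball s0 (Num.min d 1), ball x (e / 2 / M)).
  by split; apply: nbhsx_ballx => //; rewrite lt_min d0 ltr01.
move=> [t0 y] /= [st xy]; pose t := Num.max t0 0; rewrite -/t.
rewrite /ball/= lt_min in st; move: st => /andP[st1 st2].
rewrite -ball_normE /= in xy.
have tge : 0 <= t by rewrite le_max lexx orbT.
have ts := ler_dist_max0 s0 t0; rewrite -/t -/s in ts.
have h1 := le_lt_trans ts st1; have h2 := le_lt_trans ts st2.
rewrite !ltr_norml in h1 h2.
rewrite -(subrK (T t x) (T s x)) -addrA; apply: le_trans (ler_normD _ _) _.
rewrite [leRHS]splitr lerD//.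
  have [h|h] := leP s t; last by apply: main; lra.
  by rewrite distrC; apply: main; lra.
rewrite -linearB; apply: le_trans (MP _ _ _) _; first by apply/andP; split; lra.
by rewrite -ler_pdivlMl// mulrC ltW.
Qed.

End Semigroup.

(** The hypothesis says that the upper right Dini derivative is at most 0. Let [c] be the supremum
    of the points up to which [D] stays below the line of slope [e] from [a]; continuity gives the
    bound at [c], and the hypothesis pushes past [c] unless [c = b]. *)
Lemma dini_nonincreasing (R : realType) (D : R -> R) (a b : R) : a <= b ->
  continuous D ->
  (forall s, a <= s < b -> forall e : R, 0 < e -> exists2 d : R, 0 < d &
     forall h, 0 < h -> h < d -> D (s + h) <= D s + e * h) ->
  D b <= D a.
Proof.
move=> ab cD H; apply/ler_addgt0Pr => e0 e00.
pose e := e0 / (b - a + 1).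
have ee : e * (b - a + 1) = e0 by rewrite divfK// gt_eqF//; lra.
have e_gt0 : 0 < e by rewrite divr_gt0//; lra.
suff : D b <= D a + e * (b - a) by nra.
pose E := [set s | a <= s <= b /\
  forall r, a <= r <= s -> D r <= D a + e * (r - a)].
have Ea : E a.
  split=> [|r /andP[ar ra]]; first by rewrite lexx.
  have -> : r = a by lra.
  by rewrite subrr mulr0 addr0.
have supE : has_sup E.
  by split; [exists a | exists b => s [/andP[_ ?] _]].
pose c := sup E.
have ac : a <= c by exact: sup_upper_bound.
have cb : c <= b by apply: ge_sup; [exists a | move=> s [/andP[_ ?] _]].
have below r : a <= r -> r < c -> D r <= D a + e * (r - a).
  move=> ar rc; have cr : 0 < c - r by lra.
  have [s [_ Es] rs] := sup_adherent cr supE.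
  by apply: Es; rewrite ar /=; move: rs; rewrite -/c; lra.
have atc : D c <= D a + e * (c - a).
  rewrite leNgt; apply/negP => hc.
  (* Half the excess at [c]: slightly to the left of [c], [D] would still exceed the line by [g]. *)
  pose g := (D c - (D a + e * (c - a))) / 2.
  have g0 : 0 < g by rewrite /g; lra.
  have [d d0 dP] := (@continuous_distP R R^o D).1 cD c g g0.
  have [cac|cac] := eqVneq c a; first by move: hc; rewrite cac; lra.
  have {}cac : a < c by rewrite lt_neqAle eq_sym cac.
  pose r := Num.max a (c - d / 2).
  have rc : r < c by rewrite gt_max cac/=; lra.
  have ar : a <= r by rewrite le_max lexx.
  have cdr : c - d / 2 <= r by rewrite le_max lexx orbT.
  have := below r ar rc.
  have : `|D r - D c| <= g.
    by apply: dP; rewrite ltr_norml; apply/andP; split; lra.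
  by rewrite ler_norml => /andP[h1 _] h2; move: h1; rewrite /g; nra.
have [cb'|cb'] := ltP c b; last by have <- : c = b by lra.
have [|d d0 dP] := H c _ e e_gt0; first by rewrite ac.
pose h := Num.min (d / 2) (b - c).
have h0 : 0 < h by rewrite lt_min; apply/andP; split; lra.
have hd : h <= d / 2 by rewrite ge_min lexx.
have hb : h <= b - c by rewrite ge_min lexx orbT.
have : E (c + h).
  split=> [|r /andP[ar rc]]; first by apply/andP; split; lra.
  have [?|cr] := ltP r c; first exact: below.
  move: cr; rewrite le_eqVlt => /orP[/eqP <-//|cr].
  have := dP (r - c) _ _; rewrite addrCA subrr addr0 => K.
  by apply: le_trans (K _ _) _; nra.
by move=> /(sup_upper_bound supE); rewrite -/c; lra.
Qed.

(** * Generators: invariance and density of the domain, uniqueness of the semigroup *)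

Section Generator.
Context (R : realType) (X : completeNormedModType R).

Lemma diff_quotientE (T : R -> {linear X -> X}) x h : h != 0 ->
  T h x = x + h *: diff_quotient T x h.
Proof. by move=> h0; rewrite scalerA divff// scale1r addrC subrK. Qed.

Lemma orbit_continuous (T : R -> {linear X -> X}) (x : X) : C0_semigroup T ->
  continuous (fun t : R => T (Num.max t 0) x).
Proof.
move=> /semigroup_jointly_continuous; apply: (@continuous_compT _ _ _ (pair^~ x)).
by apply: (@continuous_pair _ _ _ id (cst x)) => t; [|exact: cvg_cst].
Qed.

Section OneSemigroup.
Context (A : operator X X) (T : R -> {linear X -> X}) (genA : generates A T).

(** [T h] and [T t] commute, so the quotient at [T t x] is the image under [T t] of the quotient at
    [x]. *)
Lemma generator_cvg t x : 0 <= t -> dom A x ->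
  diff_quotient T (T t x) h @[h --> 0^'+] --> T t (A x).
Proof.
move: genA => [sgT [_ gA]] t0 Ax.
apply/cvg_at_right_distP => e e0.
have [M M0 MP] := continuous_linear_bound (sg_continuous sgT t0).
have /cvg_at_right_distP/(_ _ (divr_gt0 e0 M0))[d d0 dP] := gA x Ax.
exists d => // h h0 hd.
have E : T h (T t x) = T t (T h x).
  by rewrite -(sgD sgT _ (ltW h0) t0) addrC (sgD sgT _ t0 (ltW h0)).
rewrite /diff_quotient E.
rewrite -linearB -linearZ -linearB; apply: le_trans (MP _) _.
by rewrite mulrC -ler_pdivlMr//; exact: dP.
Qed.

Lemma generator_invariant t x : 0 <= t -> dom A x ->
  dom A (T t x) /\ A (T t x) = T t (A x).
Proof.
move=> t0 Ax; have cv := generator_cvg t0 Ax; move: genA => [_ [dA gA]].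
have TAx : dom A (T t x) by rewrite dA /=; apply/cvg_ex; exists (T t (A x)).
by split=> //; exact: (cvg_unique _ (gA _ TAx) cv).
Qed.

(** The averages of the orbit of [x] over [[0, t]] lie in the domain and approach [x] as [t] tends
    to 0. *)
Lemma generator_dense x (e : R) : 0 < e -> exists2 y, dom A y & `|y - x| <= e.
Proof.
move: genA => [sgT [dA gA]] e0.
pose g t := T (Num.max t 0) x; have cg : continuous g := @orbit_continuous T x sgT.
have g0 : g 0 = x by rewrite /g maxxx (sg0 sgT).
have [d d0 dP] := (continuous_distP _).1 cg 0 e e0.
pose t := d / 2; have t0 : 0 < t by rewrite divr_gt0.
have It : `|vintegral g t - t *: x| <= t * e.
  apply: vintegral_dist => //; first exact: ltW.
  move=> r /andP[r0 rt]; rewrite -g0; apply: dP.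
  by rewrite subr0 ger0_norm// /t in rt *; lra.
exists (t^-1 *: vintegral g t); last first.
  have tV : t^-1 * t = 1 by rewrite mulVf// gt_eqF.
  rewrite -[x in _ - x]scale1r -tV -scalerA -scalerBr.
  by rewrite normrZ gtr0_norm ?invr_gt0// ler_pdivrMl.
suff It' : dom A (vintegral g t).
  by rewrite -[_ *: _]addr0; apply: domP => //; exact: dom0.
(* [T h] moves the window of integration to [[h, t + h]]: it gains a piece at [t] and loses one at
   0. *)
rewrite dA; apply/cvg_ex; exists (g t - g 0).
apply/cvg_at_right_distP => e' e'0.
have e'2 : 0 < e' / 2 by rewrite divr_gt0.
have [d1 d10 d1P] := (continuous_distP _).1 cg 0 _ e'2.
have [d2 d20 d2P] := (continuous_distP _).1 cg t _ e'2.
exists (Num.min d1 d2); first by rewrite lt_min d10 d20.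
move=> h h0; rewrite lt_min => /andP[hd1 hd2].
have Th : T h (vintegral g t) = vintegral g (t + h) - vintegral g h.
  rewrite [t + h]addrC vintegralD//; [|exact: ltW..].
  rewrite addrAC subrr add0r -vintegral_linear//; [|exact: sg_continuous (ltW h0)|exact: ltW].
  apply: eq_vintegral.
  - by apply: continuous_compT cg _; exact: sg_continuous (ltW h0).
  - apply: (continuous_compT (f := +%R h)) cg => r.
    by apply: cvgD; [exact: cvg_cst|exact: cvg_id].
  - exact: ltW.
  - move=> r /andP[r0 rt]; rewrite /g !max_l//; last by rewrite addr_ge0// ltW.
    by rewrite (sgD sgT)// ltW.
have h1 : `|vintegral g (t + h) - vintegral g t - h *: g t| <= h * (e' / 2).
  have {2 3}-> : h = t + h - t by lra.
  apply: vintegral_increment => //; [exact: ltW|lra|].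
  by move=> r /andP[r1 r2]; apply: d2P; rewrite ltr_norml; apply/andP; split; lra.
have h2 : `|vintegral g h - h *: g 0| <= h * (e' / 2).
  apply: vintegral_dist => //; first exact: ltW.
  by move=> r /andP[r1 r2]; apply: d1P; rewrite ltr_norml; apply/andP; split; lra.
rewrite /diff_quotient Th.
have hV : h * h^-1 = 1 by rewrite divff// gt_eqF.
rewrite -(@ler_pM2l _ h)// -{1}(gtr0_norm h0) -normrZ scalerBr scalerA hV scale1r.
rewrite [e' in leRHS]splitr mulrDr; apply: le_trans (lerD h1 h2).
apply: le_trans (ler_normB _ _).
have E (a b i p q : X) : a - b - i - (p - q) = (a - i - p) - (b - q).
  by rewrite !opprB (addrAC a) addrACA [RHS]addrACA [- b - p]addrC.
by rewrite scalerBr E.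
Qed.

End OneSemigroup.

(** For [x] in the domain, [D] below is nonincreasing with [D 0 = 0], and [D t] is the distance of
    the two orbits. Density and the local bounds extend the equality to all [x]. *)
Lemma generates_unique (A : operator X X) (T1 T2 : R -> {linear X -> X}) :
  generates A T1 -> generates A T2 -> forall t x, 0 <= t -> T1 t x = T2 t x.
Proof.
move=> g1 g2; have [sg1 _] := g1; have [sg2 _] := g2.
have core t x : 0 <= t -> dom A x -> T2 t x = T1 t x.
  move=> t0 Ax; have [M M0 MP] := semigroup_bounded sg1 t.
  (* The right derivative at [s] is [T1 (t - s) (A y - A y)], [y = T2 s x]. *)
  pose D s := `|T1 (Num.max (t - s) 0) (T2 (Num.max s 0) x) - T1 t x|.
  have cD : continuous D.
    move=> s; apply: cvg_norm; apply: cvgB; last exact: cvg_cst.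
    pose F s := (t - s, T2 (Num.max s 0) x).
    apply: (continuous_compT (f := F)) (semigroup_jointly_continuous sg1) s.
    apply: continuous_pair; last exact: orbit_continuous.
    by move=> r; apply: cvgB; [exact: cvg_cst|exact: cvg_id].
  have : D t <= D 0.
    apply: dini_nonincreasing => // s /andP[s0 st] e e0.
    have [Ay Ey] := generator_invariant g2 s0 Ax; set y := T2 s x in Ay Ey.
    have [_ [_ /(_ y Ay)/cvg_at_right_distP c1]] := g1.
    have [_ [_ /(_ y Ay)/cvg_at_right_distP c2]] := g2.
    (* Two difference quotients are compared with [A y], under an operator bounded by [M]. *)
    have e2 : 0 < e / (2 * M) by rewrite divr_gt0// mulr_gt0.
    have [d1 d10 d1P] := c1 _ e2; have [d2 d20 d2P] := c2 _ e2.
    exists (Num.min (Num.min d1 d2) (t - s)).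
      by rewrite !lt_min d10 d20 subr_gt0.
    move=> h h0; rewrite !lt_min => /andP[/andP[hd1 hd2] hts].
    rewrite /D !max_l; try lra.
    rewrite -lerBlDl; apply: le_trans (lerB_dist _ _) _.
    rewrite opprB addrA subrK.
    (* Both terms factor through [T1 a]: [T1 a (T2 h y)] against [T1 a (T1 h y)]. *)
    have [a [a0 at_ -> ->]] : exists a,
        [/\ 0 <= a, a <= t, t - (s + h) = a & t - s = a + h].
      by exists (t - (s + h)); split; lra.
    rewrite (sgD sg1) ?(ltW h0)//.
    rewrite [s + h]addrC (sgD sg2)//; last exact: ltW.
    rewrite -linearB; apply: le_trans (MP _ _ _) _.
      by rewrite a0.
    rewrite -/y (diff_quotientE T2 y (lt0r_neq0 h0)) (diff_quotientE T1 y (lt0r_neq0 h0)).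
    rewrite opprD addrACA subrr add0r -scalerBr.
    rewrite normrZ gtr0_norm// mulrCA mulrC ler_pM2r// -ler_pdivlMl//.
    have -> : diff_quotient T2 y h - diff_quotient T1 y h =
       (diff_quotient T2 y h - A y) - (diff_quotient T1 y h - A y).
      by rewrite opprB addrA subrK.
    apply: le_trans (ler_normB _ _) _.
    apply: le_trans (lerD (d2P _ h0 hd2) (d1P _ h0 hd1)) _.
    by rewrite le_eqVlt; apply/orP; left; apply/eqP; field; rewrite gt_eqF.
  rewrite /D subrr subr0 maxxx (sg0 sg1) (max_l t0) (sg0 sg2) subrr normr0.
  by rewrite normr_le0 subr_eq0 => /eqP.
move=> t x t0; apply/eqP; rewrite -subr_eq0 -normr_le0.
have [M1 M10 M1P] := semigroup_bounded sg1 t.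
have [M2 M20 M2P] := semigroup_bounded sg2 t.
apply/ler_addgt0Pr => e e0; rewrite add0r.
have [|y Ay yx] := @generator_dense A T1 g1 x (e / (M1 + M2)).
  by rewrite divr_gt0// addr_gt0.
have -> : T1 t x - T2 t x = T2 t (y - x) - T1 t (y - x).
  by rewrite (linearB (T1 t)) (linearB (T2 t)) (core t y)// opprB [RHS]addrC addrA subrK.
have tt : 0 <= t <= t by rewrite t0 lexx.
apply: le_trans (ler_normB _ _) _; apply: le_trans (lerD (M2P _ tt _) (M1P _ tt _)) _.
by rewrite -mulrDl addrC mulrC -ler_pdivlMr// addr_gt0.
Qed.

End Generator.

(** * Bounded perturbation *)

Section DysonPhillips.
Context (R : realType) (X : completeNormedModType R).
Context (T : R -> {linear X -> X}) (sgT : C0_semigroup T).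
Implicit Types (u v : R -> X) (x y : X) (t : R).
Context (B : {linear X -> X}) (cB : continuous B).

(* Orbits are frozen at time 0 for negative times, so that all functions of
   time below are continuous on the whole line. *)
Definition volterra (u : R -> X) (t : R) : X :=
  vintegral (fun r => T (Num.max r 0) (B (u (t - r)))) t.

Fixpoint dyson (n : nat) (x : X) (t : R) : X :=
  if n is m.+1 then volterra (dyson m x) t else T (Num.max t 0) x.

Definition dyson_sum (m : nat) (x : X) (t : R) : X := \sum_(n < m) dyson n x t.

Definition perturbed (t : R) (x : X) : X := lim (dyson_sum m x t @[m --> \oo]).

Lemma volterra_integrand_continuous u : continuous u ->
  continuous (fun p : R * R => T (Num.max p.2 0) (B (u (p.1 - p.2)))).
Proof.
move=> cu; pose F (p : R * R) := (p.2, B (u (p.1 - p.2))).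
apply: (continuous_compT (f := F)) (semigroup_jointly_continuous sgT).
apply: continuous_pair; first by move=> p; exact: cvg_snd.
apply: (continuous_compT (g := B)) => //.
apply: (continuous_compT (f := fun p : R * R => p.1 - p.2)) cu.
by move=> p; apply: cvgB; [exact: cvg_fst|exact: cvg_snd].
Qed.

Lemma volterra_integrand_continuous1 u t : continuous u ->
  continuous (fun r : R => T (Num.max r 0) (B (u (t - r)))).
Proof.
move=> cu.
apply: (continuous_compT (f := pair t)) (volterra_integrand_continuous cu).
by apply: (@continuous_pair _ _ _ (cst t) id) => r; [exact: cvg_cst|].
Qed.

Lemma volterra_continuous u : continuous u -> continuous (volterra u).
Proof.
move=> cu; apply: (@parametric_vintegral_continuous _ _
  (fun t r => T (Num.max r 0) (B (u (t - r))))).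
exact: volterra_integrand_continuous.
Qed.

Lemma dyson_continuous n x : continuous (dyson n x).
Proof.
by elim: n => [|n IH]; [exact: orbit_continuous|exact: volterra_continuous].
Qed.

Lemma dyson_sum_continuous m x : continuous (dyson_sum m x).
Proof.
elim: m => [|m IH].
  have -> : dyson_sum 0 x = cst 0 by apply/funext => t; rewrite /dyson_sum big_ord0.
  by move=> t; exact: cvg_cst.
have -> : dyson_sum m.+1 x = fun t => dyson_sum m x t + dyson m x t.
  by apply/funext => t; rewrite /dyson_sum big_ord_recr.
by move=> t; apply: cvgD; [exact: IH|exact: dyson_continuous].
Qed.

Lemma volterra_comb (a : R) u v t : continuous u -> continuous v -> 0 <= t ->
  volterra (fun r => a *: u r + v r) t = a *: volterra u t + volterra v t.
Proof.
move=> cu cv t0; rewrite /volterra -vintegral_comb//; last first.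
- exact: volterra_integrand_continuous1.
- exact: volterra_integrand_continuous1.
by congr vintegral; apply/funext => r; rewrite !linearP.
Qed.

Lemma dyson_comb n (a : R) x y t :
  dyson n (a *: x + y) t = a *: dyson n x t + dyson n y t.
Proof.
elim: n t => [|n IH] t /=; first exact: linearP.
have -> : dyson n (a *: x + y) = fun t => a *: dyson n x t + dyson n y t.
  exact/funext.
(* The induction runs over all times, so that it applies under the integral; for [t < 0] both sides
   are 0. *)
have [t0|t0] := leP 0 t; first by rewrite volterra_comb//; exact: dyson_continuous.
by rewrite /volterra !vintegral_le0 ?scaler0 ?addr0// ltW.
Qed.

(** The integrand has norm at most [K * c * expR (lam * (t - r))], which [increment_chain] compares
    with an explicit primitive [phi], so that no exponential has to be integrated. *)
Lemma volterra_contraction N : exists2 lam : R, 0 < lam &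
  forall u (c : R), continuous u -> 0 <= c ->
    (forall s, 0 <= s <= N -> `|u s| <= c * expR (lam * s)) ->
  forall t, 0 <= t <= N -> `|volterra u t| <= c / 2 * expR (lam * t).
Proof.
have [M M0 MP] := semigroup_bounded sgT N.
have [b b0 bP] := continuous_linear_bound cB.
pose K := M * b; have K0 : 0 < K by rewrite mulr_gt0.
(* The factor 4 turns the bound [K] on the kernel into the ratio [1 / 2]. *)
exists (4 * K); first by rewrite mulr_gt0.
move=> u c cu c0 uc t /andP[t0 tN].
pose f r := T (Num.max r 0) (B (u (t - r))).
have cf : continuous f by exact: volterra_integrand_continuous1.
(* Its derivative is twice the bound on the integrand; the spare factor 2 absorbs the error of steps
   of length at most [1 / (4 * K)]. *)
pose phi r := - (c / 2) * expR (4 * K * (t - r)).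
have := @increment_chain _ _ (vintegral f) phi 0 t (4 * K)^-1.
rewrite vintegral_0 subr0 => H; apply: le_trans (H _ t0 _) _.
- by rewrite invr_gt0 mulr_gt0.
- move=> p q p0 pq qt pqd; rewrite /phi.
  have : `|vintegral f q - vintegral f p - (q - p) *: 0| <=
      (q - p) * (K * (c * expR (4 * K * (t - p)))).
    apply: vintegral_increment => // r /andP[r1 r2]; rewrite subr0 /f.
    rewrite max_l; last exact: le_trans r1.
    apply: le_trans (MP _ _ _) _; first by apply/andP; split; lra.
    rewrite /K -mulrA ler_pM2l//; apply: le_trans (bP _) _; rewrite ler_pM2l//.
    apply: le_trans (uc _ _) _; first by apply/andP; split; lra.
    by rewrite ler_wpM2l// ler_expR ler_pM2l ?mulr_gt0//; lra.
  rewrite scaler0 subr0 => h; apply: le_trans h _.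
  have -> : 4 * K * (t - q) = 4 * K * (t - p) + - (4 * K * (q - p)) by ring.
  rewrite expRD expRN; set E := expR (4 * K * (t - p)).
  have E0 : 0 < E by exact: expR_gt0.
  pose y := 4 * K * (q - p); rewrite -/y.
  have y0 : 0 <= y by rewrite mulr_ge0 ?subr_ge0// ltW// mulr_gt0.
  have y1 : y <= 1.
    by rewrite /y mulrC -ler_pdivlMr ?mulr_gt0// div1r.
  (* For [0 <= y <= 1], [(1 - y / 2) * (1 + y) >= 1]. *)
  have hy : (expR y)^-1 <= 1 - y / 2.
    rewrite invf_ple ?posrE ?expR_gt0//; last lra.
    apply: le_trans (expR_ge1Dx y); rewrite -[leLHS]mul1r ler_pdivrMr; nra.
  have -> : (q - p) * (K * (c * E)) = (c / 2 * E) * (y / 2) by rewrite /y; field.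
  have cE : 0 <= c / 2 * E by rewrite mulr_ge0 ?divr_ge0// ltW.
  move: (_^-1) hy => z hz; nra.
- rewrite /phi subrr mulr0 subr0 expR0; have := expR_gt0 (4 * K * t); nra.
Qed.

(** Each Volterra step halves the weighted norm; the weight is at most [expR (lam * N)] and goes
    into [C]. *)
Lemma dyson_bound N : exists2 C : R, 0 < C &
  forall n x t, 0 <= t <= N -> `|dyson n x t| <= C / 2 ^+ n * `|x|.
Proof.
have [M M0 MP] := semigroup_bounded sgT N.
have [lam lam0 lamP] := volterra_contraction N.
exists (M * expR (lam * N)); first by rewrite mulr_gt0 ?expR_gt0.
move=> n x t tN.
apply: (@le_trans _ _ (M * `|x| / 2 ^+ n * expR (lam * t))).
  elim: n t tN => [|n IH] t tN.
    rewrite expr0 divr1 /= max_l; last by case/andP: tN.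
    apply: le_trans (MP _ tN _) _; rewrite ler_peMr ?mulr_ge0 ?(ltW M0)//.
    apply: le_trans (expR_ge1Dx _); rewrite lerDl mulr_ge0 ?(ltW lam0)//.
    by case/andP: tN.
  rewrite exprSr invfM mulrA; apply: lamP => //; first exact: dyson_continuous.
  by rewrite divr_ge0 ?mulr_ge0 ?exprn_ge0 ?(ltW M0).
rewrite [leRHS](_ : _ = M * `|x| / 2 ^+ n * expR (lam * N)); last by ring.
rewrite ler_wpM2l ?divr_ge0 ?mulr_ge0 ?exprn_ge0 ?(ltW M0)//.
by rewrite ler_expR ler_pM2l//; case/andP: tN.
Qed.

Lemma pow2_small (C : R) : 0 <= C -> forall e : R, 0 < e ->
  exists k, C / 2 ^+ k <= e.
Proof.
move=> C0 e e0; exists (Num.bound (C / e)).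
have q0 : 0 <= C / e by rewrite divr_ge0 ?(ltW e0).
have h := archi_boundP q0; move: (Num.bound _) h => n h.
rewrite ler_pdivrMr ?exprn_gt0// -ler_pdivrMl// [_ * C]mulrC.
by apply: le_trans (ltW h) _; rewrite -natrX ler_nat ltnW// ltn_expl.
Qed.

(** The tail bound is uniform in [t] on [[0, N]], hence gives continuity in time; at [k = 0] it
    bounds the sum as an operator. *)
Lemma dyson_sum_tail N : exists2 C : R, 0 < C &
  forall x t, 0 <= t <= N ->
    dyson_sum m x t @[m --> \oo] --> perturbed t x /\
    forall k, `|perturbed t x - dyson_sum k x t| <= C / 2 ^+ k * `|x|.
Proof.
have [C C0 CP] := dyson_bound N.
exists (2 * C); first by rewrite mulr_gt0.
move=> x t tN.
(* The exact finite geometric sum makes the induction on [j] close. *)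
have diff k j : `|dyson_sum (k + j) x t - dyson_sum k x t| <=
    2 * C * `|x| * ((2 ^+ k)^-1 - (2 ^+ (k + j))^-1).
  elim: j => [|j IH]; first by rewrite addn0 !subrr normr0 mulr0.
  rewrite addnS /dyson_sum big_ord_recr/= -/(dyson_sum _ _ _) addrAC.
  apply: le_trans (ler_normD _ _) _; apply: le_trans (lerD IH (CP _ _ _ tN)) _.
  rewrite exprSr invfM; move: (2 ^- (k + j)) => z.
  by rewrite le_eqVlt; apply/orP; left; apply/eqP; field.
have diff' k n : (k <= n)%N -> `|dyson_sum n x t - dyson_sum k x t| <=
    2 * C / 2 ^+ k * `|x|.
  move=> kn; rewrite -(subnKC kn); apply: le_trans (diff _ _) _.
  rewrite [leRHS](_ : _ = 2 * C * `|x| * (2 ^+ k)^-1); last by ring.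
  rewrite ler_wpM2l ?mulr_ge0 ?(ltW C0)// gerBl invr_ge0 exprn_ge0//.
have cv : dyson_sum m x t @[m --> \oo] --> perturbed t x.
  apply/cauchy_cvgP/cauchy_exP => e e0; have [||k kP] := @pow2_small (2 * C * `|x|) _ (e / 2).
  - by rewrite mulr_ge0// mulr_ge0// ltW.
  - by rewrite divr_gt0.
  exists (dyson_sum k x t); exists k => // n /= kn.
  rewrite -ball_normE /= distrC; apply: le_lt_trans (diff' _ _ kn) _.
  by rewrite mulrAC; apply: le_lt_trans kP _; lra.
split=> // k.
apply: (@cvgn_norm_le _ _ (fun m => dyson_sum m x t - dyson_sum k x t) _ _ k).
  by apply: cvgB; [exact: cv|exact: cvg_cst].
by move=> n kn; exact: diff'.
Qed.

End DysonPhillips.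

(** * The sum of the Dyson-Phillips series as a semigroup, its generator and its invariant cones *)

Lemma continuous_max0 (R : realType) : continuous (fun r : R => Num.max r 0).
Proof.
apply/(@continuous_distP R R^o) => s e e0; exists e => // t ts.
exact: le_trans (ler_dist_max0 t s) (ltW ts).
Qed.

Lemma eq_cvg_at_right (R : realType) (X : normedModType R) (f g : R -> X) (l : X) :
  (forall h, 0 < h -> f h = g h) ->
  f h @[h --> 0^'+] --> l -> g h @[h --> 0^'+] --> l.
Proof.
move=> fg /cvg_at_right_distP fl; apply/cvg_at_right_distP => e e0.
have [d d0 dP] := fl e e0.
by exists d => // h h0 hd; rewrite -fg//; exact: dP.
Qed.

Section PerturbedSemigroup.
Context (R : realType) (X : completeNormedModType R).
Context (T : R -> {linear X -> X}) (sgT : C0_semigroup T).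
Context (B : {linear X -> X}) (cB : continuous B).
Implicit Types (u v : R -> X) (x y : X) (t : R).

Local Notation volterra := (volterra T B).
Local Notation dyson := (dyson T B).
Local Notation dyson_sum := (dyson_sum T B).
Local Notation perturbed := (perturbed T B).

Lemma pow2_norm_eq0 (C : R) x : (forall k, `|x| <= C / 2 ^+ k) -> x = 0.
Proof.
move=> H; apply/eqP; rewrite -normr_le0; apply/ler_addgt0Pr => e e0.
have C0 : 0 <= C by have := H 0; rewrite expr0 divr1; exact: le_trans.
have [k kP] := pow2_small C0 e0.
by rewrite add0r; apply: le_trans (H k) kP.
Qed.

Lemma dyson_max n x t : dyson n x (Num.max t 0) = dyson n x t.
Proof.
case: n => [|n] /=; first by rewrite -maxA maxxx.
have [t0|//] := leP t 0.
by rewrite /volterra vintegral_0 vintegral_le0.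
Qed.

Lemma perturbed_max t x : perturbed (Num.max t 0) x = perturbed t x.
Proof.
rewrite /perturbed; congr (lim (_ @ \oo)); apply/funext => m.
by apply: eq_bigr => n _; exact: dyson_max.
Qed.

Lemma perturbed_comb (a : R) x y t : 0 <= t ->
  perturbed t (a *: x + y) = a *: perturbed t x + perturbed t y.
Proof.
move=> t0; have [C C0 CP] := dyson_sum_tail sgT cB t.
have tt : 0 <= t <= t by rewrite t0 lexx.
have [cx _] := CP x t tt; have [cy _] := CP y t tt.
apply: cvg_lim => //.
have -> : dyson_sum ^~ (a *: x + y) ^~ t =
    fun m => a *: dyson_sum m x t + dyson_sum m y t.
  apply/funext => m; rewrite scaler_sumr -big_split; apply: eq_bigr => n _.
  exact: dyson_comb.
by apply: cvgD => //; exact: cvgZl_tmp.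
Qed.

(** A locally uniform limit of the continuous partial sums. *)
Lemma perturbed_continuous x : continuous (perturbed^~ x).
Proof.
apply/continuous_distP => s e e0.
have [C C0 CP] := dyson_sum_tail sgT cB (Num.max s 0 + 1).
have e3 : 0 < e / 3 by rewrite divr_gt0.
have [|k kP] := @pow2_small R (C * `|x|) _ _ e3.
  by rewrite mulr_ge0// ltW.
have [d d0 dP] := (continuous_distP _).1 (@dyson_sum_continuous _ _ _ sgT _ cB k x) s _ e3.
exists (Num.min d 1); first by rewrite lt_min d0 ltr01.
move=> t; rewrite lt_min => /andP[td t1].
have tail r : r <= Num.max s 0 + 1 ->
    `|perturbed r x - dyson_sum k x r| <= e / 3.
  move=> rN; rewrite -perturbed_max.
  have -> : dyson_sum k x r = dyson_sum k x (Num.max r 0).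
    by apply: eq_bigr => n _; rewrite dyson_max.
  have [|_ H] := CP x (Num.max r 0).
    rewrite le_max lexx orbT /= ge_max rN /=.
    by rewrite addr_ge0// le_max lexx orbT.
  by apply: le_trans (H k) _; rewrite mulrAC.
have smax : s <= Num.max s 0 by rewrite le_max lexx.
have h1 : `|perturbed t x - dyson_sum k x t| <= e / 3.
  by apply: tail; move: t1; rewrite ltr_norml; lra.
have h2 : `|perturbed s x - dyson_sum k x s| <= e / 3 by apply: tail; lra.
have h3 := dP t td.
have -> : perturbed t x - perturbed s x =
    (perturbed t x - dyson_sum k x t) + (dyson_sum k x t - dyson_sum k x s) -
    (perturbed s x - dyson_sum k x s).
  by rewrite opprB !addrA !subrK.
apply: le_trans (ler_normB _ _) _; apply: le_trans (lerD (ler_normD _ _) h2) _.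
lra.
Qed.

(** The partial sums are the Picard iterates of the Volterra equation. *)
Lemma dyson_sum_recl m x t : 0 <= t ->
  dyson_sum m.+1 x t = T t x + volterra (dyson_sum m x) t.
Proof.
move=> t0; elim: m => [|m IH].
  rewrite /dyson_sum big_ord1 /= max_l//.
  have -> : (fun t => \sum_(n < 0) dyson n x t) = cst 0.
    by apply/funext => r; rewrite big_ord0.
  have -> : volterra (cst 0) t = vintegral (cst 0) t.
    by congr vintegral; apply/funext => r; rewrite /= !linear0.
  rewrite -[LHS]addr0; congr (_ + _); apply/esym/eqP.
  rewrite -normr_le0 -(mulr0 t); apply: vintegral_norm_le => //.
    exact: cst_continuous.
  by move=> r _; rewrite normr0.
rewrite /dyson_sum big_ord_recr/= -/(dyson_sum m.+1 x t) IH -addrA.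
congr (_ + _); have -> : (fun t => \sum_(n < m.+1) dyson n x t) =
    fun t => 1 *: dyson_sum m x t + dyson m x t.
  by apply/funext => r; rewrite big_ord_recr scale1r.
rewrite volterra_comb ?scale1r//.
- exact: dyson_sum_continuous.
- exact: dyson_continuous.
Qed.

(** The defect in the equation is the tail after [m.+1] terms minus the Volterra image of the tail
    after [m] terms; both are of order [1 / 2 ^+ m]. *)
Lemma perturbedE x t : 0 <= t ->
  perturbed t x = T t x + volterra (perturbed^~ x) t.
Proof.
move=> t0; have [C C0 CP] := dyson_sum_tail sgT cB t.
have [lam lam0 lamP] := volterra_contraction sgT cB t.
have tt : 0 <= t <= t by rewrite t0 lexx.
apply/eqP; rewrite -subr_eq0; apply/eqP.
apply: (@pow2_norm_eq0 (C * `|x| * (1 + expR (lam * t)))) => m.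
pose u r := (-1) *: dyson_sum m x r + perturbed r x.
have cu : continuous u.
  move=> r; apply: cvgD; last exact: perturbed_continuous.
  by apply: cvgZl_tmp; exact: dyson_sum_continuous.
have uV : volterra u t =
    volterra (perturbed^~ x) t - volterra (dyson_sum m x) t.
  rewrite volterra_comb//; last 2 first.
  - exact: dyson_sum_continuous.
  - exact: perturbed_continuous.
  by rewrite scaleN1r addrC.
have -> : perturbed t x - (T t x + volterra (perturbed^~ x) t) =
    (perturbed t x - dyson_sum m.+1 x t) - volterra u t.
  by rewrite uV dyson_sum_recl// opprB !opprD !addrA subrK.
have c0 : 0 <= C / 2 ^+ m * `|x|.
  by rewrite mulr_ge0// divr_ge0 ?exprn_ge0 ?(ltW C0).
have h1 := (CP x t tt).2 m.+1.
have h2 : `|volterra u t| <= C / 2 ^+ m * `|x| / 2 * expR (lam * t).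
  apply: lamP => // s sN; have [_ /(_ m) h] := CP x s sN.
  rewrite /u scaleN1r addrC; apply: le_trans h _; rewrite ler_peMr//.
  apply: le_trans (expR_ge1Dx _); rewrite lerDl mulr_ge0 ?(ltW lam0)//.
  by case/andP: sN.
apply: le_trans (ler_normB _ _) _; apply: le_trans (lerD h1 h2) _.
have {}c0 : 0 <= C * `|x| / 2 ^+ m by rewrite mulrAC.
have E0 : 0 <= expR (lam * t) by exact: expR_ge0.
rewrite exprSr invfM; move: c0; move: (2 ^- m) => z c0.
have : 0 <= (C * `|x| * z) * expR (lam * t) by rewrite mulr_ge0.
lra.
Qed.

Lemma perturbed0 x : perturbed 0 x = x.
Proof.
by rewrite perturbedE// (sg0 sgT) /volterra vintegral_0 addr0.
Qed.

(** A bound of [u] on [[0, t]] is halved, in the weighted norm, by each use of the equation. *)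
Lemma volterra_fixpoint_eq0 u : continuous u ->
  (forall t, 0 <= t -> u t = volterra u t) -> forall t, 0 <= t -> u t = 0.
Proof.
move=> cu uV t t0; have [lam lam0 lamP] := volterra_contraction sgT cB t.
have [c c0 cP] : exists2 c : R, 0 <= c & forall s, 0 <= s <= t -> `|u s| <= c.
  have cn : {within `[0, t], continuous (fun s => `|u s|)}.
    apply: continuous_subspaceT => s; apply: cvg_norm; exact: cu.
  have [s _ sP] := EVT_max t0 cn; by exists `|u s|.
apply: (@pow2_norm_eq0 (c * expR (lam * t))) => n.
suff : forall s, 0 <= s <= t -> `|u s| <= c / 2 ^+ n * expR (lam * s).
  by move=> /(_ t); rewrite t0 lexx mulrAC; apply.
elim: n => [|n IH] s st.
  rewrite expr0 divr1; apply: le_trans (cP _ st) _; rewrite ler_peMr//.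
  apply: le_trans (expR_ge1Dx _); rewrite lerDl mulr_ge0 ?(ltW lam0)//.
  by case/andP: st.
rewrite uV; last by case/andP: st.
rewrite exprSr invfM mulrA; apply: lamP => //.
by rewrite divr_ge0// exprn_ge0.
Qed.

(** As functions of [t], both sides solve the Volterra equation started at [perturbed s x]; their
    difference [z] is a fixed point of [volterra]. *)
Lemma perturbedD s t x : 0 <= s -> 0 <= t ->
  perturbed (t + s) x = perturbed t (perturbed s x).
Proof.
move=> s0 t0; have cp := perturbed_continuous.
pose w r := perturbed (Num.max r 0 + s) x.
have cw : continuous w.
  apply: (continuous_compT (f := fun r : R => Num.max r 0 + s)) (cp x).
  move=> r; apply: cvgD; last exact: cvg_cst.
  exact: continuous_max0.
have eqw r : 0 <= r -> w r = T r (perturbed s x) + volterra w r.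
  move=> r0; rewrite /w max_l// perturbedE ?addr_ge0//.
  pose f q := T (Num.max q 0) (B (perturbed (r + s - q) x)).
  have cf : continuous f :=
    @volterra_integrand_continuous1 _ _ _ sgT _ cB (perturbed^~ x) (r + s) (cp x).
  (* Split at [r]: the part over [[0, r]] is [volterra w r]; in the rest [T r] comes out of the
     integral and completes [T r (perturbed s x)]. *)
  rewrite {1}/volterra -/f vintegralD// perturbedE// linearD.
  rewrite (sgD sgT)// -addrA; congr (_ + _).
  rewrite [RHS]addrC; congr (_ + _).
    apply: eq_vintegral => //.
      exact: (@volterra_integrand_continuous1 _ _ _ sgT _ cB w r cw).
    move=> q /andP[q0 qr]; have rq : 0 <= r - q by rewrite subr_ge0.
    by rewrite /f /w (max_l rq) addrAC.
  have csT : continuous (T r) by exact: (sg_continuous sgT).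
  have cg := (@volterra_integrand_continuous1 _ _ _ sgT _ cB (perturbed^~ x) s (cp x)).
  rewrite /volterra -vintegral_linear//.
  apply: eq_vintegral => //.
  - apply: (continuous_compT (f := +%R r)) cf => q.
    by apply: cvgD; [exact: cvg_cst|exact: cvg_id].
  - exact: continuous_compT cg csT.
  move=> q /andP[q0 qs]; rewrite /f !max_l//; last exact: addr_ge0.
  by rewrite (sgD sgT)// opprD addrACA subrr add0r.
pose z r := (-1) *: perturbed r (perturbed s x) + w r.
have cz : continuous z.
  move=> r; apply: cvgD; last exact: cw.
  by apply: (cvgZl_tmp (f := perturbed^~ (perturbed s x))); exact: cp.
have zV r : 0 <= r -> z r = volterra z r.
  move=> r0; rewrite (@volterra_comb _ _ _ sgT _ cB (-1) _ _ r (cp _) cw r0).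
  rewrite /z eqw// [in LHS]perturbedE// !scaleN1r opprD.
  by rewrite addrACA [- _ + T r _]addrC subrr add0r.
have := volterra_fixpoint_eq0 cz zV t0.
by rewrite /z /w max_l// scaleN1r addrC => /eqP; rewrite subr_eq0 => /eqP.
Qed.

Lemma perturbed_linear t : linear (perturbed (Num.max t 0)).
Proof.
by move=> a x y; apply: perturbed_comb; rewrite le_max lexx orbT.
Qed.

(** A linear map is required at every real time, whereas [perturbed_comb] covers nonnegative times;
    hence the clamp. *)
Definition perturbed_semigroup t : {linear X -> X} :=
  HB.pack (perturbed (Num.max t 0))
    (GRing.isLinear.Build _ _ _ _ _ (perturbed_linear t)).

Lemma perturbed_semigroupE t x : perturbed_semigroup t x = perturbed t x.
Proof. exact: perturbed_max. Qed.

Lemma perturbed_C0 : C0_semigroup perturbed_semigroup.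
Proof.
split.
- move=> t t0; apply: bounded_linear_continuous.
  apply/linear_boundedP.
  have [C C0 CP] := dyson_sum_tail sgT cB t.
  exists C; split; first exact: num_real.
  move=> M CM x; rewrite perturbed_semigroupE.
  have [|_ /(_ 0)] := CP x t; first by rewrite t0 lexx.
  rewrite /dyson_sum big_ord0 subr0 expr0 divr1 => h; apply: le_trans h _.
  by rewrite ler_wpM2r// ltW.
- by move=> x; rewrite perturbed_semigroupE perturbed0.
- by move=> s t x s0 t0; rewrite !perturbed_semigroupE perturbedD.
- move=> x; rewrite -[X in _ --> X]perturbed0.
  under eq_fun do rewrite perturbed_semigroupE.
  by apply: cvg_at_right_filter; exact: perturbed_continuous.
Qed.

(** The integrand is jointly continuous with value [B (u 0)] at [(0, 0)], so its mean over [[0, h]]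
    tends to that value. *)
Lemma volterra_derivative u : continuous u ->
  h^-1 *: volterra u h @[h --> 0^'+] --> B (u 0).
Proof.
move=> cu; apply/cvg_at_right_distP => e e0.
have cF := volterra_integrand_continuous sgT cB cu.
have /cvgrPdist_le/(_ e e0)[[U V] /= [U0 V0] UV] := cF (0, 0).
move/nbhs_ballP: U0 => [d1 /= d10 d1U]; move/nbhs_ballP: V0 => [d2 /= d20 d2V].
exists (Num.min d1 d2); first by rewrite lt_min d10 d20.
move=> h h0; rewrite lt_min => /andP[hd1 hd2].
have : `|volterra u h - h *: B (u 0)| <= h * e.
  apply: vintegral_dist; [exact: volterra_integrand_continuous1|exact: ltW|].
  move=> r /andP[r0 rh]; have := UV (h, r); rewrite /= maxxx subr0 (sg0 sgT).
  rewrite distrC; apply; split.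
    by apply: d1U; rewrite /ball/= sub0r normrN gtr0_norm.
  by apply: d2V; rewrite /ball/= sub0r normrN ger0_norm// (le_lt_trans rh).
have hV : h^-1 * h = 1 by rewrite mulVf// gt_eqF.
rewrite -[B (u 0) in X in _ -> X]scale1r -hV -scalerA -scalerBr normrZ.
by rewrite gtr0_norm ?invr_gt0// ler_pdivrMl.
Qed.

(** For every [x] the two difference quotients differ by a term tending to [B x]. Hence they
    converge for the same [x], which gives both inclusions of the domains. *)
Lemma perturbed_generates (A : operator X X) : is_generator A T ->
  generates (perturb A B) perturbed_semigroup.
Proof.
move=> [dA gA]; split; first exact: perturbed_C0.
have cV x : h^-1 *: volterra (perturbed^~ x) h @[h --> 0^'+] --> B x.
  have := @volterra_derivative (perturbed^~ x) (@perturbed_continuous x).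
  by rewrite perturbed0.
have dq x h : 0 < h -> diff_quotient perturbed_semigroup x h =
    diff_quotient T x h + h^-1 *: volterra (perturbed^~ x) h.
  move=> h0; rewrite /diff_quotient perturbed_semigroupE perturbedE ?ltW//.
  by rewrite -scalerDr addrAC.
have iff x l : diff_quotient perturbed_semigroup x h @[h --> 0^'+] --> l + B x <->
    diff_quotient T x h @[h --> 0^'+] --> l.
  split=> H.
    have := cvgB H (cV x); rewrite addrK => cv.
    apply: (eq_cvg_at_right _ (cv _)) => h h0.
    by rewrite /= !fctE dq ?addrK.
  have cv := cvgD H (cV x).
  apply: (eq_cvg_at_right _ (cv _)) => h h0.
  by rewrite dq.
split=> [|x Ax]; last by apply/iff; exact: gA.
rewrite /= dA; apply/seteqP; split=> x /= /cvg_ex[l xl]; apply/cvg_ex.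
  by exists (l + B x); apply/iff.
by exists (l - B x); apply/iff; rewrite subrK.
Qed.

(** By induction the Volterra integrands take values in [K], so every term of the series lies in
    [K]; sums and limits stay there. *)
Lemma perturbed_cone (K : set X) : closed_cone K ->
  (forall t, 0 <= t -> T t @` K `<=` K) -> B @` K `<=` K ->
  forall t, 0 <= t -> perturbed t @` K `<=` K.
Proof.
move=> cK TK BK t t0 _ [x Kx <-]; have [clK K0 KD] := cK.
have Kd n s : K (dyson n x s).
  elim: n s => [|n IH] s /=.
    apply: (TK (Num.max s 0)); first by rewrite le_max lexx orbT.
    by exists x.
  have [s0|s0] := leP 0 s; last by rewrite /volterra vintegral_le0// ltW.
  apply: vintegral_cone => //.
    by apply: volterra_integrand_continuous1 => //; exact: dyson_continuous.
  move=> r r0; apply: (TK (Num.max r 0)); first by rewrite le_max lexx orbT.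
  by exists (B (dyson n x (s - r))) => //; apply: BK; exists (dyson n x (s - r)).
have [C C0 CP] := dyson_sum_tail sgT cB t.
have [|cx _] := CP x t; first by rewrite t0 lexx.
apply: (closed_cvg K clK _ _ cx); apply: nearW => m.
rewrite /dyson_sum; elim/big_ind: _ => // a b Ka Kb.
by have := KD 1 1 _ _ ler01 ler01 Ka Kb; rewrite !scale1r.
Qed.

End PerturbedSemigroup.

(** * Shape cones and preservation under the perturbation *)

Lemma shape_cone_closed_cone (R : realType) (X Y : normedModType R)
    (le : Y -> Y -> Prop) (S : operator X Y) :
  vector_order le -> closed_cone (shape_cone le S).
Proof.
move=> vo; have S0 : S 0 = 0.
  have := opP 1 (dom0 S) (dom0 S); rewrite !scale1r addr0 => /eqP.
  by rewrite -subr_eq0 opprD addrA subrr sub0r oppr_eq0 => /eqP.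
split.
- exact: closed_closure.
- by apply: subset_closure; split; [exact: dom0|rewrite S0; exact: vle_refl].
(* Before closure the set is a convex cone by linearity of [S] and the order axioms; continuity of
   the combination at [(x, y)] carries this to the closure. *)
move=> a b x y a0 b0 Kx Ky U Uxy.
have : (fun p : X * X => a *: p.1 + b *: p.2) p @[p --> (x, y)] -->
    a *: x + b *: y.
  apply: cvgD; apply: cvgZl_tmp; [exact: cvg_fst|exact: cvg_snd].
move=> /(_ U Uxy)[[V W] /= [Vx Wy] VW].
have [x' [[dx Sx] Vx']] := Kx V Vx; have [y' [[dy Sy] Wy']] := Ky W Wy.
exists (a *: x' + b *: y'); split; last exact: (VW (x', y')).
have dby : dom S (b *: y') by rewrite -[_ *: _]addr0; apply: domP; [|exact: dom0].
split; first exact: domP.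
have -> : S (a *: x' + b *: y') = a *: S x' + b *: S y'.
  rewrite opP//; congr (_ + _).
  by rewrite -[b *: y']addr0 opP ?S0 ?addr0//; exact: dom0.
have hx := vle_scale vo a0 Sx; have hy := vle_scale vo b0 Sy.
rewrite !scaler0 in hx hy.
apply: (vle_trans vo) hy _; have := vle_add vo (b *: S y') hx.
by rewrite add0r.
Qed.

Theorem corollary3p4 (R : realType) (X Y : completeNormedModType R)
    (le : Y -> Y -> Prop) (S : operator X Y) (A : operator X X)
    (T : R -> {linear X -> X}) (B : {linear X -> X}) :
  vector_order le ->
  closed (positive_cone le) ->
  closed_operator S ->
  generates A T ->
  shape_preserving le S A T ->
  continuous B ->
  B @` shape_cone le S `<=` shape_cone le S ->
  (exists T' : R -> {linear X -> X}, generates (perturb A B) T') /\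
  (forall T' : R -> {linear X -> X}, generates (perturb A B) T' ->
     shape_preserving le S (perturb A B) T').
Proof.
move=> vo _ _ [sgT gA] [SA TS] cB BS.
have gAB := perturbed_generates sgT cB gA.
split; first by exists (perturbed_semigroup sgT cB).
(* [perturb A B] has the domain of [A] by definition, so [SA] is already the first condition. *)
move=> T' gT'; split=> // t t0 _ [x Sx <-].
rewrite (generates_unique gT' gAB _ t0) perturbed_semigroupE.
apply: (perturbed_cone sgT cB (shape_cone_closed_cone S vo) TS BS t0).
by exists x.
Qed.
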